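(* There is a formula $\mathsf H(x,y)$ in the language of $\mathsf{SB}$ such that $\mathsf{SB}$ proves that $\mathsf H$ is a bijection between $\mathsf A/\mathsf E_{\mathsf A}$ and $\mathsf B/\mathsf E_{\mathsf B}$, i.e. $\mathsf{SB}$ proves: $x\mathrel{\mathsf H}y$ implies $\mathsf A x$ and $\mathsf B y$; $\mathsf H$ respects $\mathsf E_{\mathsf A}$ and $\mathsf E_{\mathsf B}$; every element of $\mathsf A$ is $\mathsf H$-related to some element; $\mathsf H$ is functional and injective modulo $\mathsf E_{\mathsf B}$ and $\mathsf E_{\mathsf A}$ respectively; and every element of $\mathsf B$ is in the range of $\mathsf H$.
   Context: The theory $\mathsf{ac}$ (adjunctive class theory) is two-sorted, with a sort of objects and a sort of classes, identity on each sort, and a membership relation $\in$ between objects and classes, with axioms: there is a class with no members; for every class $Y$ and object $y$ there is a class $X$ with $\forall x\,(x\in X\leftrightarrow (x\in Y\vee x=y))$; classes with the same members are equal. The theory $\mathsf{SB}$ is $\mathsf{ac}$ extended with unary predicates $\mathsf A,\mathsf B$ on objects and binary predicates $\mathsf E_{\mathsf A},\mathsf E_{\mathsf B},\mathsf F,\mathsf G$ on objects, with axioms stating: $\mathsf E_{\mathsf A}$ is an equivalence relation on $\{x\mid \mathsf A x\}$; $\mathsf E_{\mathsf B}$ is an equivalence relation on $\{y\mid\mathsf B y\}$; $\mathsf F$ is an injection from $\mathsf A/\mathsf E_{\mathsf A}$ to $\mathsf B/\mathsf E_{\mathsf B}$; $\mathsf G$ is an injection from $\mathsf B/\mathsf E_{\mathsf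 B}$ to $\mathsf A/\mathsf E_{\mathsf A}$. Here ''$\mathsf F$ is an injection from $\mathsf A/\mathsf E_{\mathsf A}$ to $\mathsf B/\mathsf E_{\mathsf B}$'' means: $x\mathrel{\mathsf F}y$ implies $\mathsf A x$ and $\mathsf B y$; if $x\,\mathsf E_{\mathsf A}\,x'\mathrel{\mathsf F}y'\,\mathsf E_{\mathsf B}\,y$ then $x\mathrel{\mathsf F}y$; every $x\in\mathsf A$ has some $y$ with $x\mathrel{\mathsf F}y$; $x\mathrel{\mathsf F}y$ and $x\mathrel{\mathsf F}y'$ imply $y\,\mathsf E_{\mathsf B}\,y'$; $x\mathrel{\mathsf F}y$ and $x'\mathrel{\mathsf F}y$ imply $x\,\mathsf E_{\mathsf A}\,x'$. Similarly for $\mathsf G$ with the roles of $\mathsf A,\mathsf B$ swapped. *)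

(* Defs.v *)
From Stdlib Require Import List.
Import ListNotations.

(** * Two-sorted classical first-order logic with identity

    The language is relational, so the only terms are variables.  Variables are
    de Bruijn indices, counted separately for each sort: a quantifier over sort
    [s] binds index 0 of sort [s] and leaves the indices of the other sort
    alone. *)

Inductive sort : Type := Obj | Cls.

Inductive upred : Type := pA | pB.

Inductive brel : Type := rEA | rEB | rF | rG.

Inductive form : Type :=
| Bot : form
| Eq  : sort -> nat -> nat -> form
| Mem : nat -> nat -> form  (* [Mem x X]: [x] is an object, [X] a class *)
| U   : upred -> nat -> form
| R   : brel -> nat -> nat -> form
| Imp : form -> form -> form
| And : form -> form -> form
| Or  : form -> form -> form
| All : sort -> form -> form
| Ex  : sort -> form -> form.

Definition Neg (p : form) : form := Imp p Bot.
Definition Iff (p q : form) : form := And (Imp p q) (Imp q p).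

Definition sort_eqb (s s' : sort) : bool :=
  match s, s' with
  | Obj, Obj | Cls, Cls => true
  | _, _ => false
  end.

Definition renaming : Type := sort -> nat -> nat.

Definition up (s : sort) (r : renaming) : renaming :=
  fun s' n =>
    if sort_eqb s s'
    then match n with 0 => 0 | S k => S (r s' k) end
    else r s' n.

Definition shift (s : sort) : renaming :=
  fun s' n => if sort_eqb s s' then S n else n.

Definition inst (s : sort) (t : nat) : renaming :=
  fun s' n =>
    if sort_eqb s s'
    then match n with 0 => t | S k => k end
    else n.

Fixpoint ren (r : renaming) (p : form) : form :=
  match p with
  | Bot => Bot
  | Eq s x y => Eq s (r s x) (r s y)
  | Mem x X => Mem (r Obj x) (r Cls X)
  | U P x => U P (r Obj x)
  | R Q x y => R Q (r Obj x) (r Obj y)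
  | Imp p q => Imp (ren r p) (ren r q)
  | And p q => And (ren r p) (ren r q)
  | Or p q => Or (ren r p) (ren r q)
  | All s p => All s (ren (up s r) p)
  | Ex s p => Ex s (ren (up s r) p)
  end.

(* [scoped b p]: every free variable of [p] of sort [s] has index below [b s]. *)
Fixpoint scoped (b : sort -> nat) (p : form) : Prop :=
  match p with
  | Bot => True
  | Eq s x y => x < b s /\ y < b s
  | Mem x X => x < b Obj /\ X < b Cls
  | U _ x => x < b Obj
  | R _ x y => x < b Obj /\ y < b Obj
  | Imp p q | And p q | Or p q => scoped b p /\ scoped b q
  | All s p | Ex s p =>
      scoped (fun s' => if sort_eqb s s' then S (b s') else b s') p
  end.

(* Natural deduction.  As usual, both sorts are taken to be nonempty: there is
   always a variable with which to instantiate a quantifier. *)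
Inductive prv : list form -> form -> Prop :=
| prv_hyp G p : In p G -> prv G p
| prv_dne G p : prv (Neg p :: G) Bot -> prv G p
| prv_impI G p q : prv (p :: G) q -> prv G (Imp p q)
| prv_impE G p q : prv G (Imp p q) -> prv G p -> prv G q
| prv_andI G p q : prv G p -> prv G q -> prv G (And p q)
| prv_andE1 G p q : prv G (And p q) -> prv G p
| prv_andE2 G p q : prv G (And p q) -> prv G q
| prv_orI1 G p q : prv G p -> prv G (Or p q)
| prv_orI2 G p q : prv G q -> prv G (Or p q)
| prv_orE G p q c :
    prv G (Or p q) -> prv (p :: G) c -> prv (q :: G) c -> prv G c
| prv_allI G s p : prv (map (ren (shift s)) G) p -> prv G (All s p)
| prv_allE G s p t : prv G (All s p) -> prv G (ren (inst s t) p)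
| prv_exI G s p t : prv G (ren (inst s t) p) -> prv G (Ex s p)
| prv_exE G s p c :
    prv G (Ex s p) ->
    prv (p :: map (ren (shift s)) G) (ren (shift s) c) ->
    prv G c
| prv_refl G s x : prv G (Eq s x x)
| prv_subst G s p x y :
    prv G (Eq s x y) -> prv G (ren (inst s x) p) -> prv G (ren (inst s y) p).

(** * Adjunctive class theory *)

Definition ac : list form :=
  [ Ex Cls (All Obj (Neg (Mem 0 0)));
    (* forall Y y, exists X, forall x, x in X <-> x in Y \/ x = y *)
    All Cls (All Obj (Ex Cls (All Obj
      (Iff (Mem 0 0) (Or (Mem 0 1) (Eq Obj 0 1))))));
    All Cls (All Cls
      (Imp (All Obj (Iff (Mem 0 1) (Mem 0 0))) (Eq Cls 1 0))) ].

(** * Virtual quotients and maps between them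

    Predicates and relations on objects are given as functions from the indices
    of the argument variables to formulas. *)

(* As a relation on {x | P x}, [E] only relates elements of it. *)
Definition equivalence (P : nat -> form) (E : nat -> nat -> form) : list form :=
  [ All Obj (All Obj (Imp (E 1 0) (And (P 1) (P 0))));
    All Obj (Imp (P 0) (E 0 0));
    All Obj (All Obj (Imp (E 1 0) (E 0 1)));
    All Obj (All Obj (All Obj (Imp (And (E 2 1) (E 1 0)) (E 2 0)))) ].

Definition injection (P : nat -> form) (EP : nat -> nat -> form)
    (Q : nat -> form) (EQ : nat -> nat -> form)
    (M : nat -> nat -> form) : list form :=
  [ All Obj (All Obj (Imp (M 1 0) (And (P 1) (Q 0))));
    (* forall x x' y' y *)
    All Obj (All Obj (All Obj (All Obj
      (Imp (And (EP 3 2) (And (M 2 1) (EQ 1 0))) (M 3 0)))));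
    All Obj (Imp (P 0) (Ex Obj (M 1 0)));
    (* forall x y y' *)
    All Obj (All Obj (All Obj (Imp (And (M 2 1) (M 2 0)) (EQ 1 0))));
    (* forall x x' y *)
    All Obj (All Obj (All Obj (Imp (And (M 2 0) (M 1 0)) (EP 2 1)))) ].

Definition bijection (P : nat -> form) (EP : nat -> nat -> form)
    (Q : nat -> form) (EQ : nat -> nat -> form)
    (M : nat -> nat -> form) : list form :=
  injection P EP Q EQ M ++ [ All Obj (Imp (Q 0) (Ex Obj (M 0 1))) ].

Definition SB : list form :=
  ac
  ++ equivalence (U pA) (R rEA)
  ++ equivalence (U pB) (R rEB)
  ++ injection (U pA) (R rEA) (U pB) (R rEB) (R rF)
  ++ injection (U pB) (R rEB) (U pA) (R rEA) (R rG).

(** * Formulas H(x,y) as binary relations on objects *)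

(* The free variables of [H] are among x (object index 0) and y (object
   index 1). *)
Definition binary_formula (H : form) : Prop :=
  scoped (fun s => match s with Obj => 2 | Cls => 0 end) H.

Definition app2 (H : form) (x y : nat) : form :=
  ren (fun s n =>
         match s, n with
         | Obj, 0 => x
         | Obj, 1 => y
         | _, _ => n
         end) H.

(* Main.v *)
Require Import Defs.
From Stdlib Require Import List Lia.
Import ListNotations.

(** Put k = G o F, an injection of A/E_A into itself.  The usual
    Schroeder-Bernstein argument (use F on C and the inverse of G off C) only
    needs a definable C with C = (A \ ran G) u k[C].  Call a class X "closed" if
    each of its members lies in A and is outside ran G or in k[X], and let C be
    the union of all closed classes.  Then C is contained in
    (A \ ran G) u k[C]; conversely, if X is closed and x is in (A \ ran G) u k[X],
    then X u {x} is closed.  Adjunction is thus all that is needed: there is no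
    induction, no comprehension and no coding of finite sequences. *)

(** * Derived rules *)

Lemma prv_weaken G G' p : prv G p -> incl G G' -> prv G' p.
Proof.
  intros H; revert G'; induction H; intros G' HG.
  - apply prv_hyp; auto.
  - apply prv_dne, IHprv, incl_cons; [left | apply incl_tl]; auto.
  - apply prv_impI, IHprv, incl_cons; [left | apply incl_tl]; auto.
  - apply prv_impE with p; auto.
  - apply prv_andI; auto.
  - apply prv_andE1 with q; auto.
  - apply prv_andE2 with p; auto.
  - apply prv_orI1; auto.
  - apply prv_orI2; auto.
  - apply prv_orE with p q; auto;
      [apply IHprv2 | apply IHprv3]; apply incl_cons;
      (left; reflexivity) || (apply incl_tl; auto).
  - apply prv_allI, IHprv, incl_map, HG.
  - apply prv_allE; auto.
  - apply prv_exI with t; auto.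
  - apply prv_exE with s p; auto.
    apply IHprv2, incl_cons; [left | apply incl_tl, incl_map]; auto.
  - apply prv_refl.
  - apply prv_subst with x; auto.
Qed.

Lemma prv_cons G p q : prv G q -> prv (p :: G) q.
Proof. intros H; apply prv_weaken with G; auto using incl_tl, incl_refl. Qed.

Lemma prv_cut G p q : prv G p -> prv (p :: G) q -> prv G q.
Proof. intros Hp Hq; exact (prv_impE _ _ _ (prv_impI _ _ _ Hq) Hp). Qed.

Lemma prv_exfalso G p : prv G Bot -> prv G p.
Proof. intros H; apply prv_dne, prv_cons, H. Qed.

Lemma prv_absurd G p q : prv G (Neg p) -> prv G p -> prv G q.
Proof. intros Hn Hp; exact (prv_exfalso _ _ (prv_impE _ _ _ Hn Hp)). Qed.

Lemma prv_em G p : prv G (Or p (Neg p)).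
Proof.
  apply prv_dne, prv_impE with (Or p (Neg p)); [apply prv_hyp; left; reflexivity |].
  apply prv_orI2, prv_impI, prv_impE with (Or p (Neg p)).
  - apply prv_hyp; right; left; reflexivity.
  - apply prv_orI1, prv_hyp; left; reflexivity.
Qed.

(** The result is left as nested renamings; for a concrete [p] they compute away, so instances of
    axioms are obtained by conversion. *)
Lemma prv_all2E G p x y :
  prv G (All Obj (All Obj p)) ->
  prv G (ren (inst Obj y) (ren (up Obj (inst Obj x)) p)).
Proof. intros H; exact (prv_allE _ _ _ y (prv_allE _ _ _ x H)). Qed.

Lemma prv_all3E G p x y z :
  prv G (All Obj (All Obj (All Obj p))) ->
  prv G (ren (inst Obj z) (ren (up Obj (inst Obj y))
    (ren (up Obj (up Obj (inst Obj x))) p))).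
Proof. intros H; exact (prv_allE _ _ _ z (prv_all2E _ _ x y H)). Qed.

(** The comparison is up to conversion, so hypotheses under [map (ren (shift s))] are found in their
    shifted form. *)
Ltac hyp := apply prv_hyp; repeat (first [left; reflexivity | right]).

(** * Quotients and injections *)

Section Equivalence.
Variables (P : upred) (E : brel) (G : list form).
Hypothesis HG : incl (equivalence (U P) (R E)) G.

Lemma equiv_refl x : prv G (U P x) -> prv G (R E x x).
Proof.
  intros H.
  assert (K : prv G (All Obj (Imp (U P 0) (R E 0 0))))
    by (apply prv_hyp, HG; cbn; tauto).
  exact (prv_impE _ _ _ (prv_allE _ _ _ x K) H).
Qed.

Lemma equiv_sym x y : prv G (R E x y) -> prv G (R E y x).
Proof.
  intros H.
  assert (K : prv G (All Obj (All Obj (Imp (R E 1 0) (R E 0 1)))))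
    by (apply prv_hyp, HG; cbn; tauto).
  exact (prv_impE _ _ _ (prv_all2E _ _ x y K) H).
Qed.

Lemma equiv_domr x y : prv G (R E x y) -> prv G (U P y).
Proof.
  intros H.
  assert (K : prv G (All Obj (All Obj (Imp (R E 1 0) (And (U P 1) (U P 0))))))
    by (apply prv_hyp, HG; cbn; tauto).
  exact (prv_andE2 _ _ _ (prv_impE _ _ _ (prv_all2E _ _ x y K) H)).
Qed.

End Equivalence.

Section Injection.
Variables (P : upred) (EP : brel) (Q : upred) (EQ M : brel) (G : list form).
Hypothesis HG : incl (injection (U P) (R EP) (U Q) (R EQ) (R M)) G.

Lemma inj_field x y : prv G (R M x y) -> prv G (And (U P x) (U Q y)).
Proof.
  intros H.
  assert (K : prv G (All Obj (All Obj (Imp (R M 1 0) (And (U P 1) (U Q 0))))))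
    by (apply prv_hyp, HG; cbn; tauto).
  exact (prv_impE _ _ _ (prv_all2E _ _ x y K) H).
Qed.

Lemma inj_dom x y : prv G (R M x y) -> prv G (U P x).
Proof. intros H; exact (prv_andE1 _ _ _ (inj_field _ _ H)). Qed.

Lemma inj_cod x y : prv G (R M x y) -> prv G (U Q y).
Proof. intros H; exact (prv_andE2 _ _ _ (inj_field _ _ H)). Qed.

Lemma inj_congr x x' y' y :
  prv G (R EP x x') -> prv G (R M x' y') -> prv G (R EQ y' y) ->
  prv G (R M x y).
Proof.
  intros H1 H2 H3.
  assert (K : prv G (All Obj (All Obj (All Obj (All Obj
      (Imp (And (R EP 3 2) (And (R M 2 1) (R EQ 1 0))) (R M 3 0)))))))
    by (apply prv_hyp, HG; cbn; tauto).
  exact (prv_impE _ _ _ (prv_allE _ _ _ y (prv_all3E _ _ x x' y' K))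
           (prv_andI _ _ _ H1 (prv_andI _ _ _ H2 H3))).
Qed.

Lemma inj_total x : prv G (U P x) -> prv G (Ex Obj (R M (S x) 0)).
Proof.
  intros H.
  assert (K : prv G (All Obj (Imp (U P 0) (Ex Obj (R M 1 0)))))
    by (apply prv_hyp, HG; cbn; tauto).
  exact (prv_impE _ _ _ (prv_allE _ _ _ x K) H).
Qed.

Lemma inj_fun x y y' :
  prv G (R M x y) -> prv G (R M x y') -> prv G (R EQ y y').
Proof.
  intros H1 H2.
  assert (K : prv G (All Obj (All Obj (All Obj
      (Imp (And (R M 2 1) (R M 2 0)) (R EQ 1 0))))))
    by (apply prv_hyp, HG; cbn; tauto).
  exact (prv_impE _ _ _ (prv_all3E _ _ x y y' K) (prv_andI _ _ _ H1 H2)).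
Qed.

Lemma inj_inj x x' y :
  prv G (R M x y) -> prv G (R M x' y) -> prv G (R EP x x').
Proof.
  intros H1 H2.
  assert (K : prv G (All Obj (All Obj (All Obj
      (Imp (And (R M 2 0) (R M 1 0)) (R EP 2 1))))))
    by (apply prv_hyp, HG; cbn; tauto).
  exact (prv_impE _ _ _ (prv_all3E _ _ x x' y K) (prv_andI _ _ _ H1 H2)).
Qed.

End Injection.

(** * Extensions of SB *)

Lemma SB_cons G p : incl SB G -> incl SB (p :: G).
Proof. apply incl_tl. Qed.

(** The axioms are sentences, so shifting fixes them; computation confirms this for each sort. This
    keeps SB available under binders. *)
Lemma SB_shift s G : incl SB G -> incl SB (map (ren (shift s)) G).
Proof.
  intros H.
  replace SB with (map (ren (shift s)) SB) by (destruct s; reflexivity).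
  apply incl_map, H.
Qed.

Lemma SB_EA G : incl SB G -> incl (equivalence (U pA) (R rEA)) G.
Proof. intros H p Hp; apply H; unfold SB; rewrite !in_app_iff; auto. Qed.

Lemma SB_EB G : incl SB G -> incl (equivalence (U pB) (R rEB)) G.
Proof. intros H p Hp; apply H; unfold SB; rewrite !in_app_iff; auto. Qed.

Lemma SB_F G :
  incl SB G -> incl (injection (U pA) (R rEA) (U pB) (R rEB) (R rF)) G.
Proof. intros H p Hp; apply H; unfold SB; rewrite !in_app_iff; auto. Qed.

Lemma SB_G G :
  incl SB G -> incl (injection (U pB) (R rEB) (U pA) (R rEA) (R rG)) G.
Proof. intros H p Hp; apply H; unfold SB; rewrite !in_app_iff; auto 6. Qed.

Lemma SB_empty G : incl SB G -> prv G (Ex Cls (All Obj (Neg (Mem 0 0)))).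
Proof. intros H; apply prv_hyp, H; left; reflexivity. Qed.

(* X = Y u {y} *)
Definition adjoined (Y y X : nat) : form :=
  All Obj (Iff (Mem 0 X) (Or (Mem 0 Y) (Eq Obj 0 (S y)))).

Lemma SB_adjoin G Y y :
  incl SB G ->
  prv G (Ex Cls (adjoined (S Y) y 0)).
Proof.
  intros H.
  assert (K : prv G (All Cls (All Obj (Ex Cls (All Obj
      (Iff (Mem 0 0) (Or (Mem 0 1) (Eq Obj 0 1))))))))
    by (apply prv_hyp, H; right; left; reflexivity).
  exact (prv_allE _ _ _ y (prv_allE _ _ _ Y K)).
Qed.

Create HintDb sb.
#[local] Hint Resolve SB_cons SB_shift SB_EA SB_EB SB_F SB_G : sb.

Ltac sb := auto 20 with sb nocore.

(** * Closed classes *)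

Definition in_ran_G (z : nat) : form := Ex Obj (R rG 0 (S z)).

Definition in_k_image (X z : nat) : form :=
  Ex Obj (Ex Obj (And (Mem 0 X) (And (R rF 0 1) (R rG 1 (S (S z)))))).

Definition step (X z : nat) : form :=
  And (U pA z) (Or (Neg (in_ran_G z)) (in_k_image X z)).

Definition closed (X : nat) : form := All Obj (Imp (Mem 0 X) (step X 0)).

(** The C of the overview, kept as a formula because the union of all closed classes need not be a
    class. *)
Definition chain (x : nat) : form := Ex Cls (And (Mem x 0) (closed 0)).

Definition subclass (X Y : nat) : form := All Obj (Imp (Mem 0 X) (Mem 0 Y)).

Definition sb_bij (x y : nat) : form :=
  Or (And (chain x) (R rF x y)) (And (And (U pA x) (Neg (chain x))) (R rG y x)).

Lemma subclass_mem G X Y x :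
  prv G (subclass X Y) -> prv G (Mem x X) -> prv G (Mem x Y).
Proof. intros H1 H2; exact (prv_impE _ _ _ (prv_allE _ _ _ x H1) H2). Qed.

Lemma closed_step G X x :
  prv G (closed X) -> prv G (Mem x X) -> prv G (step X x).
Proof. intros H1 H2; exact (prv_impE _ _ _ (prv_allE _ _ _ x H1) H2). Qed.

Lemma chain_intro G X x :
  prv G (closed X) -> prv G (Mem x X) -> prv G (chain x).
Proof. intros H1 H2; exact (prv_exI _ Cls (And (Mem x 0) (closed 0)) X (prv_andI _ _ _ H2 H1)). Qed.

Lemma in_ran_G_intro G y z : prv G (R rG y z) -> prv G (in_ran_G z).
Proof. intros H; exact (prv_exI G Obj (R rG 0 (S z)) y H). Qed.

Lemma in_k_image_intro G X x y z :
  prv G (Mem x X) -> prv G (R rF x y) -> prv G (R rG y z) ->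
  prv G (in_k_image X z).
Proof.
  intros H1 H2 H3; apply prv_exI with y, prv_exI with x.
  exact (prv_andI _ _ _ H1 (prv_andI _ _ _ H2 H3)).
Qed.

(* In the side premise the new variables are y = 1 and z' = 0, where
   z' F y and y G z. *)
Lemma in_k_image_elim G X z c :
  prv G (in_k_image X z) ->
  prv (R rG 1 (S (S z)) :: R rF 0 1 :: Mem 0 X ::
       map (ren (shift Obj)) (map (ren (shift Obj)) G))
      (ren (shift Obj) (ren (shift Obj) c)) ->
  prv G c.
Proof.
  intros H K; apply (prv_exE _ _ _ _ H).
  eapply prv_exE; [hyp |].
  set (D := And _ _).
  assert (HD : forall L, prv (D :: L) D) by (intros; hyp).
  (* The conjuncts of [D] enter the context one by one; the final weakening from [K] accounts for
     [D] and the intermediate existential left behind. *)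
  apply prv_cut with (Mem 0 X); [exact (prv_andE1 _ _ _ (HD _)) |].
  apply prv_cut with (R rF 0 1);
    [exact (prv_cons _ _ _ (prv_andE1 _ _ _ (prv_andE2 _ _ _ (HD _)))) |].
  apply prv_cut with (R rG 1 (S (S z)));
    [exact (prv_cons _ _ _ (prv_cons _ _ _
       (prv_andE2 _ _ _ (prv_andE2 _ _ _ (HD _))))) |].
  apply (prv_weaken _ _ _ K).
  intros p; cbn [map In]; tauto.
Qed.

(** [X] occurs in [step] only positively, in the membership inside [in_k_image]. *)
Lemma step_mono G X Y z :
  prv G (subclass X Y) -> prv G (step X z) -> prv G (step Y z).
Proof.
  intros HXY H; apply prv_andI; [exact (prv_andE1 _ _ _ H) |].
  apply (prv_orE _ _ _ _ (prv_andE2 _ _ _ H)); [apply prv_orI1; hyp |].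
  (* Once cut into the context, the inclusion is shifted along with it when binders are opened; the
     same device recurs below. *)
  apply prv_orI2, (prv_cut _ (subclass X Y)); [apply prv_cons, HXY |].
  apply in_k_image_elim with X z; [hyp |].
  apply in_k_image_intro with 0 1; [apply subclass_mem with X | |]; hyp.
Qed.

Lemma adjoined_elim G Y y X z :
  prv G (adjoined Y y X) -> prv G (Mem z X) ->
  prv G (Or (Mem z Y) (Eq Obj z y)).
Proof.
  intros H1 H2.
  exact (prv_impE _ _ _ (prv_andE1 _ _ _ (prv_allE _ _ _ z H1)) H2).
Qed.

Lemma adjoined_intro G Y y X z :
  prv G (adjoined Y y X) -> prv G (Or (Mem z Y) (Eq Obj z y)) ->
  prv G (Mem z X).
Proof.
  intros H1 H2.
  exact (prv_impE _ _ _ (prv_andE2 _ _ _ (prv_allE _ _ _ z H1)) H2).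
Qed.

Lemma adjoined_mem G Y y X : prv G (adjoined Y y X) -> prv G (Mem y X).
Proof.
  intros H; apply (adjoined_intro _ _ _ _ _ H), prv_orI2, prv_refl.
Qed.

Lemma adjoined_sub G Y y X : prv G (adjoined Y y X) -> prv G (subclass Y X).
Proof.
  intros H; apply (prv_cut _ _ _ H), prv_allI, prv_impI.
  apply adjoined_intro with Y (S y); [hyp | apply prv_orI1; hyp].
Qed.

Lemma step_eq G X z z' :
  prv G (Eq Obj z z') -> prv G (step X z') -> prv G (step X z).
Proof.
  intros H H'.
  (* Symmetry of identity: in [Eq Obj z z] only the left side, the hole at index 0, is replaced. *)
  assert (K : prv G (Eq Obj z' z))
    by exact (prv_subst _ _ (Eq Obj 0 (S z)) _ _ H (prv_refl _ _ z)).
  exact (prv_subst _ _ (step X 0) _ _ K H').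
Qed.

(** Old members satisfy [step] over [Y] by closedness and the new one by hypothesis; monotonicity
    carries this from [Y] to the larger [X]. *)
Lemma adjoined_closed G Y y X :
  prv G (adjoined Y y X) -> prv G (closed Y) -> prv G (step Y y) ->
  prv G (closed X).
Proof.
  intros H HY Hy.
  apply (prv_cut _ _ _ H), (prv_cut _ (closed Y)), (prv_cut _ (step Y y));
    auto using prv_cons.
  apply prv_allI, prv_impI, step_mono with Y;
    [apply adjoined_sub with (S y); hyp |].
  eapply prv_orE; [apply adjoined_elim with (y := S y) (X := X); hyp | |].
  - apply closed_step; hyp.
  - apply step_eq with (S y); hyp.
Qed.

(** Adjoining [x] to [X] gives a closed class that contains it. This is where the adjunction axiom
    enters. *)
Lemma step_chain G X x :
  incl SB G -> prv G (closed X) -> prv G (step X x) -> prv G (chain x).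
Proof.
  intros HG HX Hx.
  apply (prv_cut _ _ _ HX), (prv_cut _ (step X x)); [apply prv_cons, Hx |].
  eapply prv_exE; [apply SB_adjoin with (Y := X) (y := x); sb |].
  apply chain_intro with 0;
    [apply adjoined_closed with (S X) x | apply adjoined_mem with (S X)]; hyp.
Qed.

(** The witnessing class stays available as class 0, so that a predecessor of [x] found in it is
    seen to satisfy [chain] as well. *)
Lemma chain_elim G x c :
  prv G (chain x) ->
  prv (step 0 x :: closed 0 :: map (ren (shift Cls)) G) (ren (shift Cls) c) ->
  prv G c.
Proof.
  intros H K; apply (prv_exE _ _ _ _ H).
  set (D := And _ _).
  assert (HD : forall L, prv (D :: L) D) by (intros; hyp).
  apply prv_cut with (closed 0); [exact (prv_andE2 _ _ _ (HD _)) |].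
  apply prv_cut with (step 0 x).
  - apply closed_step; [hyp | exact (prv_cons _ _ _ (prv_andE1 _ _ _ (HD _)))].
  - apply (prv_weaken _ _ _ K); intros p; cbn [In]; tauto.
Qed.

(** The empty class is vacuously closed, and a point of A outside the range of G satisfies [step]
    over it. *)
Lemma chain_not_ran_G G x :
  incl SB G -> prv G (U pA x) -> prv G (Neg (in_ran_G x)) -> prv G (chain x).
Proof.
  intros HG Hx Hn.
  apply (prv_cut _ _ _ Hx), (prv_cut _ (Neg (in_ran_G x)));
    [apply prv_cons, Hn |].
  eapply prv_exE; [apply SB_empty; sb |].
  apply step_chain with 0; [sb | |].
  - apply prv_allI, prv_impI, prv_absurd with (Mem 0 0); [| hyp].
    refine (prv_allE _ Obj (Neg (Mem 0 0)) 0 _); hyp.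
  - apply prv_andI; [| apply prv_orI1]; hyp.
Qed.

(** If a closed class contains [x], then [z] lies in its image under k, so [z] can be adjoined to
    it. *)
Lemma chain_k G x y z :
  incl SB G -> prv G (chain x) -> prv G (R rF x y) -> prv G (R rG y z) ->
  prv G (chain z).
Proof.
  intros HG Hx Hxy Hyz.
  apply (prv_cut _ _ _ Hxy), (prv_cut _ (R rG y z)); [apply prv_cons, Hyz |].
  eapply prv_exE; [apply prv_cons, prv_cons, Hx |].
  assert (HD : forall L, prv (And (Mem x 0) (closed 0) :: L)
                             (And (Mem x 0) (closed 0))) by (intros; hyp).
  apply step_chain with 0; [sb | exact (prv_andE2 _ _ _ (HD _)) |].
  apply prv_andI.
  - eapply inj_cod; [apply SB_G; sb |]; hyp.
  - apply prv_orI2, in_k_image_intro with x y;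
      [exact (prv_andE1 _ _ _ (HD _)) | hyp | hyp].
Qed.

Lemma G_congr G x y y' :
  incl SB G -> prv G (R rG x y) -> prv G (R rEA y y') -> prv G (R rG x y').
Proof.
  intros HG H1 H2; apply inj_congr with (1 := SB_G _ HG) (x' := x) (y' := y);
    auto.
  apply equiv_refl with pB; [sb |].
  exact (inj_dom _ _ _ _ _ _ (SB_G _ HG) _ _ H1).
Qed.

Lemma not_in_ran_G_congr G x x' :
  incl SB G -> prv G (R rEA x x') -> prv G (Neg (in_ran_G x)) ->
  prv G (Neg (in_ran_G x')).
Proof.
  intros HG HE Hn; apply prv_impI.
  apply (prv_cut _ (R rEA x x')), (prv_cut _ (Neg (in_ran_G x)));
    auto using prv_cons.
  eapply prv_exE; [hyp |].
  apply prv_absurd with (in_ran_G (S x)); [hyp |].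
  apply in_ran_G_intro with 0, G_congr with (S x'); [sb | hyp |].
  apply equiv_sym with pA; [sb | hyp].
Qed.

(** A closed class containing [x] need not contain the equivalent [x']. However, [step] respects E_A
    because G does, so [x'] can be adjoined. *)
Lemma chain_congr G x x' :
  incl SB G -> prv G (R rEA x x') -> prv G (chain x) -> prv G (chain x').
Proof.
  intros HG HE Hx.
  apply (prv_cut _ _ _ HE), (chain_elim _ x); [apply prv_cons, Hx |].
  apply step_chain with 0; [sb | hyp |].
  apply prv_andI.
  - eapply equiv_domr; [apply SB_EA; sb |]; hyp.
  - eapply prv_orE; [eapply prv_andE2; hyp | |].
    + apply prv_orI1, not_in_ran_G_congr with x; [sb | hyp | hyp].
    + apply prv_orI2, in_k_image_elim with 0 x; [hyp |].
      apply in_k_image_intro with 0 1; [hyp | hyp |].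
      apply G_congr with (S (S x)); [sb | hyp | hyp].
Qed.

(** * The bijection *)

Lemma sb_bij_chain G x y :
  prv G (chain x) -> prv G (R rF x y) -> prv G (sb_bij x y).
Proof. intros H1 H2; exact (prv_orI1 _ _ _ (prv_andI _ _ _ H1 H2)). Qed.

Lemma sb_bij_nchain G x y :
  incl SB G -> prv G (Neg (chain x)) -> prv G (R rG y x) -> prv G (sb_bij x y).
Proof.
  intros HG H1 H2; apply prv_orI2, prv_andI; [apply prv_andI |]; auto.
  exact (inj_cod _ _ _ _ _ _ (SB_G _ HG) _ _ H2).
Qed.

Lemma sb_bij_elim G x y c :
  prv G (sb_bij x y) ->
  prv (chain x :: R rF x y :: G) c ->
  prv (Neg (chain x) :: R rG y x :: G) c -> prv G c.
Proof.
  intros H K1 K2; apply (prv_orE _ _ _ _ H); set (D := And _ _);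
    assert (HD : forall L, prv (D :: L) D) by (intros; hyp).
  - apply prv_cut with (R rF x y); [exact (prv_andE2 _ _ _ (HD _)) |].
    apply prv_cut with (chain x);
      [exact (prv_cons _ _ _ (prv_andE1 _ _ _ (HD _))) |].
    apply (prv_weaken _ _ _ K1); intros p; cbn [In]; tauto.
  - apply prv_cut with (R rG y x); [exact (prv_andE2 _ _ _ (HD _)) |].
    apply prv_cut with (Neg (chain x));
      [exact (prv_cons _ _ _ (prv_andE2 _ _ _ (prv_andE1 _ _ _ (HD _)))) |].
    apply (prv_weaken _ _ _ K2); intros p; cbn [In]; tauto.
Qed.

Lemma sb_bij_field G x y :
  incl SB G -> prv G (sb_bij x y) -> prv G (And (U pA x) (U pB y)).
Proof.
  intros HG H; apply (sb_bij_elim _ _ _ _ H).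
  - eapply inj_field; [apply SB_F; sb | hyp].
  - apply prv_andI.
    + eapply inj_cod; [apply SB_G; sb | hyp].
    + eapply inj_dom; [apply SB_G; sb | hyp].
Qed.

Lemma sb_bij_congr G x x' y' y :
  incl SB G -> prv G (R rEA x x') -> prv G (sb_bij x' y') ->
  prv G (R rEB y' y) -> prv G (sb_bij x y).
Proof.
  intros HG Hx H Hy.
  apply (prv_cut _ _ _ Hx), (prv_cut _ (R rEB y' y)); [apply prv_cons, Hy |].
  assert (K : forall L, incl SB L -> prv L (R rEA x x') -> prv L (R rEA x' x))
    by (intros L HL; apply equiv_sym with pA; sb).
  apply (sb_bij_elim _ x' y'); [auto using prv_cons | |].
  - apply sb_bij_chain.
    + apply chain_congr with x'; [sb | apply K; [sb | hyp] | hyp].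
    + eapply inj_congr; [apply SB_F; sb | hyp ..].
  - apply sb_bij_nchain; [sb | |].
    (* Were [x] in C, its equivalent [x'] would be too. *)
    + apply prv_impI, prv_absurd with (chain x'); [hyp |].
      apply chain_congr with x; [sb | hyp | hyp].
    + eapply inj_congr with (x' := y') (y' := x');
        [apply SB_G; sb | | hyp | apply K; [sb | hyp]].
      apply equiv_sym with pB; [sb | hyp].
Qed.

Lemma sb_bij_total G x :
  incl SB G -> prv G (U pA x) -> prv G (Ex Obj (sb_bij (S x) 0)).
Proof.
  intros HG Hx; apply (prv_cut _ _ _ Hx).
  apply (prv_orE _ _ _ _ (prv_em _ (chain x))).
  - eapply prv_exE.
    + eapply inj_total with (x := x); [apply SB_F; sb | hyp ..].
    + apply prv_exI with 0, sb_bij_chain; hyp.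
  - apply (prv_orE _ _ _ _ (prv_em _ (in_ran_G x))).
    + eapply prv_exE; [hyp |].
      apply prv_exI with 0, sb_bij_nchain; [sb | hyp | hyp].
    (* Outside both C and the range of G there is no element of A. *)
    + apply prv_absurd with (chain x); [hyp |].
      apply chain_not_ran_G; [sb | hyp | hyp].
Qed.

Lemma sb_bij_fun G x y y' :
  incl SB G -> prv G (sb_bij x y) -> prv G (sb_bij x y') -> prv G (R rEB y y').
Proof.
  intros HG H H'.
  apply (sb_bij_elim _ _ _ _ H);
    (apply (sb_bij_elim _ x y'); [auto using prv_cons | |]).
  - eapply inj_fun with (x := x); [apply SB_F; sb | hyp ..].
  - apply prv_absurd with (chain x); hyp.
  - apply prv_absurd with (chain x); hyp.
  - eapply inj_inj with (y := x); [apply SB_G; sb | hyp ..].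
Qed.

(** In a mixed case, say [x] in C with x F y and [x'] outside C with y G x', the point [x'] is an
    image of [x] under k and so lies in C, a contradiction. *)
Lemma sb_bij_inj G x x' y :
  incl SB G -> prv G (sb_bij x y) -> prv G (sb_bij x' y) -> prv G (R rEA x x').
Proof.
  intros HG H H'.
  apply (sb_bij_elim _ _ _ _ H);
    (apply (sb_bij_elim _ x' y); [auto using prv_cons | |]).
  - eapply inj_inj with (y := y); [apply SB_F; sb | hyp ..].
  - apply prv_absurd with (chain x'); [hyp |].
    apply chain_k with x y; [sb | hyp | hyp | hyp].
  - apply prv_absurd with (chain x); [hyp |].
    apply chain_k with x' y; [sb | hyp | hyp | hyp].
  - eapply inj_fun with (x := y); [apply SB_G; sb | hyp ..].
Qed.

(** Take z with y G z. If z is outside C, it is the preimage. Otherwise z, being in the range of G,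
    comes from some x in C with x F y' and y' G z; injectivity of G makes y' equivalent to [y], so x
    F y. *)
Lemma sb_bij_surj G y :
  incl SB G -> prv G (U pB y) -> prv G (Ex Obj (sb_bij 0 (S y))).
Proof.
  intros HG Hy.
  apply (prv_exE _ _ _ _ (inj_total _ _ _ _ _ _ (SB_G _ HG) _ Hy)).
  apply (prv_orE _ _ _ _ (prv_em _ (chain 0))).
  - eapply chain_elim; [hyp |].
    eapply prv_orE; [eapply prv_andE2; hyp | |].
    + apply prv_absurd with (in_ran_G 0); [hyp |].
      apply in_ran_G_intro with (S y); hyp.
    + eapply in_k_image_elim; [hyp |].
      apply prv_exI with 0, sb_bij_chain; [apply chain_intro with 0; hyp |].
      (* Here 0 is x, 1 is y', 2 is z, and the given [y] has been shifted three times. *)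
      eapply inj_congr with (x' := 0) (y' := 1); [apply SB_F; sb | | |].
      * apply equiv_refl with pA; [sb |].
        eapply inj_dom; [apply SB_F; sb | hyp ..].
      * hyp.
      * eapply inj_inj with (y := 2); [apply SB_G; sb | hyp ..].
  - apply prv_exI with 0, sb_bij_nchain; [sb | hyp | hyp].
Qed.

Theorem theorem4p4 :
  exists H : form,
    binary_formula H /\
    forall p : form,
      In p (bijection (U pA) (R rEA) (U pB) (R rEB) (app2 H)) -> prv SB p.
Proof.
  (* [app2 (sb_bij 0 1) x y] computes to [sb_bij x y], so the lemmas above match the clauses by
     conversion. *)
  exists (sb_bij 0 1); split; [cbv -[lt]; repeat split; lia |].
  assert (HSB : incl SB SB) by apply incl_refl.
  intros p [<- | [<- | [<- | [<- | [<- | [<- | []]]]]]].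
  - do 2 apply prv_allI; apply prv_impI.
    apply sb_bij_field; [sb | hyp].
  - do 4 apply prv_allI; apply prv_impI.
    (* The bound variables x, x', y', y have indices 3, 2, 1, 0. *)
    apply sb_bij_congr with 2 1; [sb | | |].
    + eapply prv_andE1; hyp.
    + eapply prv_andE1, prv_andE2; hyp.
    + eapply prv_andE2, prv_andE2; hyp.
  - apply prv_allI, prv_impI.
    apply sb_bij_total; [sb | hyp].
  - do 3 apply prv_allI; apply prv_impI.
    apply sb_bij_fun with 2; [sb | |].
    + eapply prv_andE1; hyp.
    + eapply prv_andE2; hyp.
  - do 3 apply prv_allI; apply prv_impI.
    apply sb_bij_inj with 0; [sb | |].
    + eapply prv_andE1; hyp.
    + eapply prv_andE2; hyp.
  - apply prv_allI, prv_impI.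
    apply sb_bij_surj; [sb | hyp].
Qed.
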